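(* Let $G_0^*$ be a $k$-uniform hypergraph with vertices $v_1,\dots,v_n$ ($n\ge1$), and let $G_1^*$ and $H_1^*$ be non-isomorphic $(k,r)$-regular hypergraphs on $m\ge2$ vertices whose adjacency matrices have the same spectrum, where $2\le k\le m+1$. Let $G^*$ (resp. $H^*$) be the generalized corona $G_0^*\odot_1^n G_i^*$ with $p=1$, $t=n$, $U_i=\{v_i\}$ and $G_i^*=G_1^*$ (resp. $G_i^*=H_1^*$) for all $i$. Then $G^*$ and $H^*$ are not regular (not every vertex lies in the same number of hyperedges), and $S(G^* )$ and $S(H^* )$ have the same spectrum.
   Context: All hypergraphs are finite and simple: a hypergraph $G^*=(V,E)$ consists of a finite vertex set $V$ and a set $E$ of subsets of $V$ (hyperedges), each of size at least $2$. It is $k$-uniform if every hyperedge has exactly $k$ elements, and $(k,r)$-regular if it is $k$-uniform and every vertex lies in exactly $r$ hyperedges. For a hypergraph with vertices $v_1,\dots,v_n$, the adjacency matrix $A(G^* )$ is the $n\times n$ matrix whose $(i,j)$ entry, for $i\ne j$, is the number of hyperedges containing both $v_i$ and $v_j$, and whose diagonal entries are $0$; the Seidel matrix is $S(G^* )=J_n-I_n-2A(G^* )$, where $J_n$ is the all-ones matrix and $I_n$ the identity. Generalized corona: let $G_0^*$ be a $k$-uniform hypergraph with vertex set $V_0$, $\{U_1,\dots,U_t\}$ a partition of $V_0$ with $|U_i|=p$, and $G_1^*,\dots,G_t^*$ $k$-uniform hypergraphs. The generalized corona $G_0^*\odot_p^t G_i^*$ is the $k$-uniform hypergraph obtained as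 follows: for each $i$ take $p$ copies $G_i^{*(1)},\dots,G_i^{*(p)}$ of $G_i^*$, all copies pairwise vertex-disjoint and disjoint from $V_0$. The vertex set is $V_0$ together with the vertices of all copies; the hyperedges are the hyperedges of $G_0^*$, the hyperedges of every copy, and, for every $i\in\{1,\dots,t\}$ and $j\in\{1,\dots,p\}$, every $k$-element subset of $U_i\cup V(G_i^{*(j)})$ that meets both $U_i$ and $V(G_i^{*(j)})$. *)

(* Defs.v *)
From mathcomp Require Import all_boot all_order all_algebra.
Set Implicit Arguments. Unset Strict Implicit. Unset Printing Implicit Defensive.
Import GRing.Theory Num.Theory.
Local Open Scope ring_scope.

Definition is_hypergraph (V : finType) (E : {set {set V}}) : Prop :=
  forall e, e \in E -> (2 <= #|e|)%N.

Definition uniform (V : finType) (k : nat) (E : {set {set V}}) : Prop :=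
  forall e, e \in E -> #|e| = k.

Definition hdeg (V : finType) (E : {set {set V}}) (v : V) : nat :=
  #|[set e in E | v \in e]|.

Definition regular_hg (V : finType) (E : {set {set V}}) : Prop :=
  exists r : nat, forall v : V, hdeg E v = r.

Definition kr_regular (V : finType) (k r : nat) (E : {set {set V}}) : Prop :=
  uniform k E /\ forall v : V, hdeg E v = r.

Definition hg_isomorphic (V W : finType) (E : {set {set V}}) (F : {set {set W}}) : Prop :=
  exists f : V -> W, bijective f /\ forall e : {set V}, (e \in E) = (f @: e \in F).

Definition adjmx (V : finType) (E : {set {set V}}) : 'M[int]_(#|V|) :=
  \matrix_(i, j) (if i == j then 0
                  else (#|[set e in E | (enum_val i \in e) && (enum_val j \in e)]|)%:Z).

Definition seidelmx (V : finType) (E : {set {set V}}) : 'M[int]_(#|V|) :=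
  const_mx 1 - 1%:M - 2 *: adjmx E.

Definition cospectral (n m : nat) (A : 'M[int]_n) (B : 'M[int]_m) : Prop :=
  char_poly A = char_poly B.

(* Generalized corona G0 \odot_1^n G_i with p = 1, t = n, U_i = {v_i} and all
   G_i equal to the same hypergraph (W, E1).  Vertex set: V0 + (V0 * W), where
   inr (v, w) is the copy of w in the copy of G1 attached to v. *)
Definition corona1 (V0 W : finType) (k : nat) (E0 : {set {set V0}})
    (E1 : {set {set W}}) : {set {set (V0 + V0 * W)%type}} :=
  [set e : {set (V0 + V0 * W)%type} |
     [|| [exists f in E0, e == [set inl x | x in f]],
         [exists v : V0, exists f in E1, e == [set inr (v, w) | w in f]]
       | [exists v : V0,
           [&& e \subset (inl v |: [set inr (v, w) | w : W]), #|e| == k,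
               inl v \in e & [exists w : W, inr (v, w) \in e]]]]].

(* Main.v *)
(* Spectrum.  Write N = (X + 1 - 2 d) I + 2 A(G_1), where d is the number of
   cross hyperedges containing two given vertices of a copy.  Collapsing each
   copy of G_1 to a point gives P : V0 + V0 * W -> V0 + V0, and the matrix
   X I - S of the corona is diag (I, I (x) N) + P K P^T, where K depends only
   on G_0, k and m.  Since G_1 is regular, the all-ones vector is an eigenvector
   of N, so diag (I, I (x) N) P = P L with L diagonal, and Sylvester's
   determinant identity expresses det (X I - S) through det N and data that do
   not depend on G_1; det N is determined by the spectrum of A(G_1).

   Non-regularity.  Two complete k-uniform hypergraphs of the same order are
   isomorphic and completeness can be read off r, so neither G_1 nor H_1 is
   complete, whence r < C(m-1, k-1).  A vertex of a copy then has degree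
   r + C(m-1, k-2) < C(m, k-1), while the cross hyperedges alone give a vertex
   of G_0 degree at least C(m, k-1). *)
Require Import Defs.
From mathcomp Require Import all_boot all_order all_algebra.
From mathcomp Require Import perm ring.

Set Implicit Arguments.
Unset Strict Implicit.
Unset Printing Implicit Defensive.

Import GRing.Theory.

(** * Determinants of matrices indexed by finite types *)

Section FunMatrix.
Local Open Scope ring_scope.

Definition fun_mx (R : Type) (T U : finType) (f : T -> U -> R) :
    'M[R]_(#|T|, #|U|) :=
  \matrix_(i, j) f (enum_val i) (enum_val j).

Lemma eq_fun_mx (R : Type) (T U : finType) (f g : T -> U -> R) :
  f =2 g -> fun_mx f = fun_mx g.
Proof. by move=> fg; apply/matrixP => i j; rewrite !mxE fg. Qed.

Lemma mul_fun_mx (R : pzSemiRingType) (T U Z : finType)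
    (f : T -> U -> R) (g : U -> Z -> R) :
  fun_mx f *m fun_mx g = fun_mx (fun x z => \sum_y f x y * g y z).
Proof.
apply/matrixP => i k; rewrite !mxE.
rewrite (reindex _ (onW_bij _ (enum_val_bij U))) /=.
by apply: eq_bigr => j _; rewrite !mxE.
Qed.

(** Another enumeration applies one permutation to rows and columns, and its two signs cancel. *)
Lemma det_fun_mx (R : comPzRingType) (T : finType) (f : T -> T -> R) n
    (e : 'I_n -> T) :
  bijective e -> \det (fun_mx f) = \det (\matrix_(i, j) f (e i) (e j)).
Proof.
move=> e_bij; have en : n = #|T| by rewrite -(bij_eq_card e_bij) card_ord.
subst n; have s_inj : injective (enum_rank \o e).
  by move=> i j /enum_rank_inj/(bij_inj e_bij).
pose s := perm s_inj.
have -> : \matrix_(i, j) f (e i) (e j) = row_perm s (col_perm s (fun_mx f)).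
  by apply/matrixP => i j; rewrite !mxE !permE /= !enum_rankK.
rewrite row_permE col_permE !det_mulmx !det_perm mulrCA.
by rewrite odd_permV -signr_addb addbb mulr1.
Qed.

Lemma det_fun_mx_bij (R : comPzRingType) (T U : finType) (f : T -> T -> R)
    (e : U -> T) :
  bijective e -> \det (fun_mx f) = \det (fun_mx (fun i j => f (e i) (e j))).
Proof.
by move=> e_bij; apply: det_fun_mx; apply: bij_comp e_bij (enum_val_bij U).
Qed.

Lemma det_fun_mx_sum (R : comPzRingType) (T U : finType)
    (f : T + U -> T + U -> R) :
  (forall x y, f (inl x) (inr y) = 0) ->
  \det (fun_mx f) = \det (fun_mx (fun x y => f (inl x) (inl y))) *
                    \det (fun_mx (fun x y => f (inr x) (inr y))).
Proof.
move=> f0; pose e (i : 'I_(#|T| + #|U|)) : T + U :=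
  match split i with inl j => inl (enum_val j) | inr j => inr (enum_val j) end.
have e_bij : bijective e.
  exists (fun x => unsplit match x with
    inl a => inl (enum_rank a) | inr b => inr (enum_rank b) end) => [i|x].
    by rewrite /e -[RHS]splitK; case: (split i) => j; rewrite enum_valK.
  by rewrite /e unsplitK; case: x => a; rewrite enum_rankK.
rewrite (det_fun_mx f e_bij).
have -> : \matrix_(i, j) f (e i) (e j) =
  block_mx (fun_mx (fun x y => f (inl x) (inl y))) 0
           (fun_mx (fun x y => f (inr x) (inl y)))
           (fun_mx (fun x y => f (inr x) (inr y))).
  apply/matrixP => i j; rewrite !mxE /e.
  by case: (split i) => i'; rewrite !mxE; case: (split j) => j'; rewrite !mxE.
by rewrite det_lblock.
Qed.

Lemma det_fun_mx_diag (R : comPzRingType) (T : finType) (d : T -> R) :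
  \det (fun_mx (fun x y => (x == y)%:R * d x)) = \prod_x d x.
Proof.
rewrite (reindex _ (onW_bij _ (enum_val_bij T))) /=.
have -> : fun_mx (fun x y => (x == y)%:R * d x) =
          diag_mx (\row_i d (enum_val i)).
  apply/matrixP => i j; rewrite !mxE (inj_eq enum_val_inj).
  by case: eqP => _; rewrite ?mul1r ?mul0r ?mulr1n ?mulr0n.
by rewrite det_diag; apply: eq_bigr => i _; rewrite mxE.
Qed.

(** The matrix is block diagonal with [#|T|] equal blocks. They are split off one by one by
    induction over ['I_n]; a general [T] is reached through [enum_val]. *)
Lemma det_fun_mx_tensor (R : comPzRingType) (T U : finType) (f : U -> U -> R) :
  \det (fun_mx (fun x y : T * U => (x.1 == y.1)%:R * f x.2 y.2)) =
  \det (fun_mx f) ^+ #|T|.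
Proof.
have ord_case n : \det (fun_mx (fun x y : 'I_n * U =>
    (x.1 == y.1)%:R * f x.2 y.2)) = \det (fun_mx f) ^+ n.
  elim: n => [|n IHn].
    have e0 : #|{: 'I_0 * U}| = 0%N by rewrite card_prod card_ord.
    by move: (fun_mx _); rewrite e0 => M; rewrite det_mx00.
  pose e (x : U + 'I_n * U) : 'I_n.+1 * U :=
    match x with inl u => (ord0, u) | inr (i, u) => (lift ord0 i, u) end.
  have e_inj : injective e.
    move=> [u|[i u]] [v|[j v]] //= [] => [-> //|/val_inj -> -> //].
  have e_bij : bijective e.
    apply: (inj_card_bij e_inj).
    by rewrite card_sum !card_prod !card_ord mulSn.
  rewrite (det_fun_mx_bij _ e_bij) det_fun_mx_sum => [|u [i v]]; last first.
    by rewrite mul0r.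
  rewrite exprS -IHn; congr (_ * _); congr (\det _); apply: eq_fun_mx.
    by move=> u v; rewrite /= mul1r.
  by move=> [i u] [j v]; rewrite /= (inj_eq lift_inj).
have e_bij : bijective (fun x : 'I_#|T| * U => (enum_val x.1, x.2)).
  exists (fun x => (enum_rank x.1, x.2)) => [] [i u] /=.
    by rewrite enum_valK.
  by rewrite enum_rankK.
rewrite (det_fun_mx_bij _ e_bij) -ord_case; congr (\det _).
by apply: eq_fun_mx => [] [i u] [j v] /=; rewrite (inj_eq enum_val_inj).
Qed.

End FunMatrix.

(** * Reduction of a corona determinant to the quotient [V + V] *)

Section CoronaDeterminant.
Local Open Scope ring_scope.

(* Sylvester's identity det (1 + XY) = det (1 + YX), cleared of the inverses of
   D and L: both sides compute the determinant of
   [[D, V], [- K U, 1]] * [[1, - V], [0, L]]. *)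
Lemma det_add_mulmx (R : comPzRingType) n p (D : 'M[R]_n) (V : 'M_(n, p))
    (L K : 'M_p) (U : 'M_(p, n)) :
  D *m V = V *m L ->
  \det (D + V *m (K *m U)) * \det L = \det D * \det (L + K *m U *m V).
Proof.
move=> DV; pose M := block_mx D V (- (K *m U)) 1%:M.
have detM : \det M = \det (D + V *m (K *m U)).
  have := det_mulmx M (block_mx 1%:M 0 (K *m U) 1%:M).
  rewrite /M mulmx_block det_lblock !det1 !mulr1 => <-.
  rewrite !mulmx1 mul1mx !mulmx0 !add0r addNr.
  by rewrite det_ublock det1 mulr1.
have := det_mulmx M (block_mx 1%:M (- V) 0 L).
rewrite detM det_ublock det1 mul1r => <-.
rewrite /M mulmx_block !mulmx1 !mulmx0 !addr0 mulmxN DV addNr mul1mx.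
by rewrite det_lblock mulNmx mulmxN opprK (addrC L).
Qed.

Variables (R : comPzRingType) (V W : finType).
Implicit Types (N : W -> W -> R) (K : V + V -> V + V -> R) (lam : R).

Definition corona_proj (x : V + V * W) : V + V :=
  match x with inl a => inl a | inr u => inr u.1 end.

Definition corona_diag N (x y : V + V * W) : R :=
  match x, y with
  | inl a, inl b => (a == b)%:R
  | inr u, inr v => (u.1 == v.1)%:R * N u.2 v.2
  | _, _ => 0
  end.

(** Used twice: with the row sum of [N] it is the diagonal of [L], with [#|W|] it lists the fibre
    sizes of [corona_proj]. *)
Definition quot_diag lam (s : V + V) : R := if s is inr _ then lam else 1.

(** This is [det_add_mulmx] for the incidence matrix [P] of [corona_proj] and its transpose [Q]. The
    factor [lam ^+ #|V|] is the determinant of [L], kept on the left to avoid a division. *)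
Lemma det_corona N K lam :
  (forall w, \sum_w' N w w' = lam) ->
  \det (fun_mx (fun x y =>
          corona_diag N x y + K (corona_proj x) (corona_proj y))) *
    lam ^+ #|V| =
  \det (fun_mx N) ^+ #|V| *
  \det (fun_mx (fun s t => (s == t)%:R * quot_diag lam s +
                           K s t * quot_diag #|W|%:R t)).
Proof.
move=> N_lam.
pose P := fun_mx (fun x s => (corona_proj x == s)%:R : R).
pose Q := fun_mx (fun s x => (s == corona_proj x)%:R : R).
pose L := fun_mx (fun s t => (s == t)%:R * quot_diag lam s : R).
pose D := fun_mx (corona_diag N).
have delta_suml (T : finType) (s : T) (F : T -> R) :
    \sum_t (s == t)%:R * F t = F s.
  rewrite (bigD1 s) //= eqxx mul1r big1 ?addr0 // => t.
  by rewrite eq_sym => /negPf ->; rewrite mul0r.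
have delta_sumr (T : finType) (s : T) (F : T -> R) :
    \sum_t F t * (t == s)%:R = F s.
  rewrite -[RHS](delta_suml _ s); apply: eq_bigr => t _.
  by rewrite mulrC eq_sym.
(* Multiplying by [P] sums the rows of [D] over fibres: 1 at a base vertex, the row sum [lam] of [N]
   in a copy. *)
have DP : D *m P = P *m L.
  rewrite !mul_fun_mx; apply: eq_fun_mx => x s.
  rewrite delta_suml big_sumType /=.
  case: x => [a|[v w]] /=.
    rewrite delta_suml [X in _ + X]big1 ?addr0 ?mulr1 // => u _.
    by rewrite mul0r.
  rewrite [X in X + _]big1 ?add0r => [|a _]; last by rewrite mul0r.
  rewrite -(pair_bigA _ (fun v' w' =>
    (v == v')%:R * N w w' * (inr v' == s)%:R)) /= -(N_lam w).
  rewrite -(delta_suml _ v (fun v' => (inr v' == s)%:R * \sum_w' N w w')).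
  apply: eq_bigr => v' _; rewrite mulrA mulr_sumr; apply: eq_bigr => w' _.
  by rewrite -!mulrA [_ * N _ _]mulrC.
have QP : Q *m P = fun_mx (fun s t => (s == t)%:R * quot_diag #|W|%:R t).
  rewrite mul_fun_mx; apply: eq_fun_mx => s t; rewrite big_sumType /=.
  rewrite -(pair_bigA _ (fun v' (_ : W) =>
    (s == inr v')%:R * (inr v' == t)%:R)) /=.
  case: t => b.
    rewrite [X in _ + X]big1 ?addr0 => [|v _]; last first.
      by rewrite big1 // => w _; rewrite mulr0.
    by rewrite /= mulr1 -(delta_sumr _ b (fun a => (s == inl a)%:R)).
  rewrite [X in X + _]big1 ?add0r => [|a _]; last by rewrite mulr0.
  rewrite -(delta_sumr _ b (fun a => (s == inr a)%:R * #|W|%:R)).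
  apply: eq_bigr => v _; rewrite sumr_const -[LHS]mulr_natr -!mulrA.
  by rewrite [#|W|%:R * _]mulrC.
have := det_add_mulmx (fun_mx K) Q DP.
have -> : \det L = lam ^+ #|V|.
  by rewrite det_fun_mx_diag big_sumType /= big1_eq mul1r prodr_const.
have -> : \det D = \det (fun_mx N) ^+ #|V|.
  rewrite det_fun_mx_sum // det_fun_mx_tensor.
  have := det_fun_mx_diag (fun _ : V => 1 : R).
  rewrite big1_eq => det1; rewrite -[RHS]mul1r -[in RHS]det1.
  congr (\det _ * _).
  by apply: eq_fun_mx => a b /=; rewrite mulr1.
rewrite -mulmxA QP !mul_fun_mx => E.
transitivity (\det (D + fun_mx (fun x y => K (corona_proj x) (corona_proj y)))
              * lam ^+ #|V|).
  by congr (\det _ * _); apply/matrixP => i j; rewrite !mxE.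
(* The pullback of [K] along the projection is the product [P K Q]. *)
rewrite -[X in _ + X](_ : fun_mx (fun x z =>
    \sum_s (corona_proj x == s)%:R *
    \sum_t K s t * (t == corona_proj z)%:R) = _); last first.
  by apply: eq_fun_mx => x y; rewrite delta_suml delta_sumr.
rewrite {}E; congr (_ * \det _); apply/matrixP => i j; rewrite !mxE.
congr (_ + _); under eq_bigr do rewrite mulrA.
set t := enum_val j; rewrite -mulr_suml; congr (_ * _).
exact: delta_sumr.
Qed.

End CoronaDeterminant.

(** * Degrees and codegrees in uniform hypergraphs *)

Section Counting.
Variable T : finType.
Implicit Types (E : {set {set T}}) (S : {set T}) (x y : T).

Definition codeg E x y := #|[set e in E | (x \in e) && (y \in e)]|.

Definition ksets k := [set e : {set T} | #|e| == k].

Lemma hdegE E x : hdeg E x = codeg E x x.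
Proof. by apply: eq_card => e; rewrite !inE andbb. Qed.

Lemma codegC E x y : codeg E x y = codeg E y x.
Proof. by apply: eq_card => e; rewrite !inE [(x \in e) && _]andbC. Qed.

(** Removing [S] is a bijection onto the subsets of its complement of size [k - #|S|]. The boolean
    factor guards against truncated subtraction, which would give a binomial ['C(_, 0) = 1] when [S]
    is too large. *)
Lemma card_ksets_sup S k :
  #|[set e in ksets k | S \subset e]| =
  (#|S| <= k) * 'C(#|T| - #|S|, k - #|S|).
Proof.
have [leSk|ltkS] := leqP; last first.
  apply: eq_card0 => e; rewrite !inE; apply/negP.
  by case/andP => /eqP ek /subset_leq_card; rewrite ek leqNgt ltkS.
have cSC : #|~: S| = #|T| - #|S| by rewrite [LHS]cardsCs setCK.
have USK (g : {set T}) : g \subset ~: S -> (S :|: g) :\: S = g.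
  move=> gS; rewrite setDUl setDv set0U.
  by apply/setDidPl; rewrite disjoints_subset.
rewrite mul1n -cSC -cards_draws.
pose D := [set A : {set T} | A \subset ~: S & #|A| == k - #|S|].
rewrite -(card_in_imset (f := fun g => S :|: g) (D := mem D)) =>
    [|g h]; last first.
  by rewrite !inE => /andP[/USK gE _] /andP[/USK hE _] Sgh; rewrite -gE Sgh.
apply: eq_card => e; rewrite !inE.
apply/andP/imsetP => [[/eqP ek Se]|[g]].
  exists (e :\: S); last by rewrite -{1}(setID e S) (setIidPr Se).
  by rewrite !inE subDset setUCr subsetT cardsDS // ek eqxx.
rewrite !inE => /andP[gS /eqP gk] ->; rewrite subsetUl; split => //.
have := cardsUI S g; rewrite [S :&: g]setIC.
have /setDidPl : g :\: S = g by rewrite setDE; apply/setIidPl.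
move=> /disjoint_setI0 ->.
by rewrite cards0 addn0 gk => ->; rewrite subnKC.
Qed.

(** Here [(x != y).+1] is the size of the set [[set x; y]], so degrees and codegrees are covered
    together. *)
Lemma codeg_ksets x y k :
  codeg (ksets k) x y =
  ((x != y).+1 <= k) * 'C(#|T| - (x != y).+1, k - (x != y).+1).
Proof.
rewrite -[(x != y).+1]add1n addnC addn1 -cards2 -card_ksets_sup.
by apply: eq_card => e; rewrite !inE subUset !sub1set.
Qed.

(** Double counting of the pairs [(y, e)] with [x] and [y] in [e] gives [r * k], of which [y = x]
    accounts for [r]. These are the row sums of the adjacency matrix. *)
Lemma sum_codeg E k r x :
  kr_regular k r E -> \sum_(y | y != x) codeg E x y = r * k.-1.
Proof.
case=> Ek /(_ x); rewrite hdegE => Er.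
have : \sum_y codeg E x y = r * k.
  rewrite -Er -sum_nat_const.
  have codegE y : codeg E x y =
      \sum_(e in [set e in E | (x \in e) && (x \in e)]) (y \in e).
    rewrite /codeg -sum1_card big_mkcond [RHS]big_mkcond /=.
    by apply: eq_bigr => e _; rewrite !inE; do 3 case: (_ \in _).
  under eq_bigr do rewrite codegE.
  rewrite exchange_big; apply: eq_bigr => e; rewrite inE => /andP[/Ek <- _].
  by rewrite -sum1_card [RHS]big_mkcond.
rewrite (bigD1 x) //= Er => /eqP.
case: k Ek => [|j] Ek; last by rewrite mulnS eqn_add2l => /eqP.
by rewrite muln0 addn_eq0 => /andP[_ /eqP].
Qed.

(** The binomial is the degree in the complete hypergraph. Equality at one vertex gives equality at
    all, as [r] is constant; then every star is complete, and each [k.+1]-set lies in some star. *)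
Lemma hdeg_lt_complete E k r x :
  kr_regular k.+1 r E -> (r < 'C(#|T|.-1, k)) = (E != ksets k.+1).
Proof.
case=> Ek Er.
have EsubK : E \subset ksets k.+1.
  by apply/subsetP => e /Ek ek; rewrite inE ek.
have r_le y : r <= 'C(#|T|.-1, k) ?= iff
    ([set e in E | y \in e] == [set e in ksets k.+1 | y \in e]).
  rewrite -{1}(Er y).
  have <- : #|[set e in ksets k.+1 | y \in e]| = 'C(#|T|.-1, k).
    have := codeg_ksets y y k.+1; rewrite eqxx mul1n !subn1 /= => <-.
    by rewrite -hdegE.
  apply: subset_leqif_cards; apply/subsetP => e; rewrite !inE.
  by case/andP => /Ek -> ->; rewrite eqxx.
rewrite (ltn_leqif (r_le x)) -(r_le x); congr (~~ _).
apply/eqP/eqP => [r_eq|EK]; last by apply/eqP; rewrite (r_le x) EK.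
apply/eqP; rewrite eqEsubset EsubK; apply/subsetP => e; rewrite inE => eK.
have [y ye] : exists y, y \in e.
  by apply/set0Pn; rewrite -card_gt0 (eqP eK).
move/eqP: r_eq; rewrite (r_le y) => /eqP/setP/(_ e).
by rewrite !inE ye !andbT eK.
Qed.
End Counting.

Lemma ksets_isomorphic (T U : finType) k :
  #|T| = #|U| -> hg_isomorphic (ksets T k) (ksets U k).
Proof.
move=> eqTU; pose f x := enum_val (cast_ord eqTU (enum_rank x)).
have f_inj : injective f.
  by move=> x y /enum_val_inj/cast_ord_inj/enum_rank_inj.
exists f; split; first by apply: inj_card_bij => //; rewrite eqTU.
by move=> e; rewrite !inE card_imset.
Qed.

(** * Hyperedges and codegrees of the corona *)

Section CoronaCodegree.
Variables (V W : finType) (k : nat).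
Variables (E0 : {set {set V}}) (E : {set {set W}}).
Hypothesis k_gt1 : 1 < k.

Local Notation corona := (corona1 k E0 E).
Definition base_edge (f : {set V}) : {set V + V * W} := [set inl x | x in f].
Definition copy_edge v (f : {set W}) : {set V + V * W} :=
  [set inr (v, w) | w in f].
Definition cone_edge v f := inl v |: copy_edge v f.

Lemma inl_base_edge a f : (inl a \in base_edge f) = (a \in f).
Proof. by rewrite mem_imset //; apply: inl_inj. Qed.

Lemma inr_base_edge u f : (inr u \in base_edge f) = false.
Proof. by apply/imsetP => [[]]. Qed.

Lemma inl_copy_edge a v f : (inl a \in copy_edge v f) = false.
Proof. by apply/imsetP => [[]]. Qed.

Lemma inr_copy_edge u v f :
  (inr u \in copy_edge v f) = (u.1 == v) && (u.2 \in f).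
Proof.
apply/imsetP/andP => [[w wf [->]]|[/eqP <- uf]]; first by rewrite eqxx.
by exists u.2 => //; case: u uf.
Qed.

Lemma inl_cone_edge a v f : (inl a \in cone_edge v f) = (a == v).
Proof. by rewrite inE inl_copy_edge orbF in_set1 (inj_eq inl_inj). Qed.

Lemma inr_cone_edge u v f :
  (inr u \in cone_edge v f) = (u.1 == v) && (u.2 \in f).
Proof. by rewrite inE in_set1 inr_copy_edge. Qed.

Definition in_edge :=
  (inl_base_edge, inr_base_edge, inl_copy_edge, inr_copy_edge,
   inl_cone_edge, inr_cone_edge).

Lemma base_edge_inj : injective base_edge.
Proof.
by move=> f g /setP fg; apply/setP => a; rewrite -!inl_base_edge.
Qed.

Lemma copy_edge_inj v : injective (copy_edge v).
Proof.
move=> f g /setP fg; apply/setP => w.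
by have := fg (inr (v, w)); rewrite !in_edge eqxx.
Qed.

Lemma cone_edge_inj v : injective (cone_edge v).
Proof.
move=> f g /setP fg; apply/setP => w.
by have := fg (inr (v, w)); rewrite !in_edge eqxx.
Qed.

Lemma card_cone_edge v f : #|cone_edge v f| = #|f|.+1.
Proof.
rewrite cardsU1 inl_copy_edge card_imset //.
by move=> w w' [].
Qed.

(** Each part [U_i] is a single vertex, so a cross hyperedge is that vertex joined to a subset of
    its copy of size [k.-1], nonempty because [1 < k]. *)
Lemma coronaP e :
  reflect [\/ exists2 f, f \in E0 & e = base_edge f,
              exists v, exists2 f, f \in E & e = copy_edge v f |
              exists v, exists2 f, f \in ksets W k.-1 & e = cone_edge v f]
          (e \in corona).
Proof.
rewrite inE; apply: (iffP or3P) => [[]|[]].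
- by case/exists_inP => f fE /eqP ->; constructor 1; exists f.
- by case/existsP => v /exists_inP[f fE /eqP ->]; constructor 2; exists v, f.
- case/existsP => v /and4P[/subsetP es /eqP ek ve _]; constructor 3.
  have {}es x : x \in e -> x \in cone_edge v setT.
    move/es; case/setU1P => [->|/imsetP[w _ ->]]; first exact: setU11.
    by rewrite in_edge !inE eqxx.
  exists v; pose f := [set w | inr (v, w) \in e].
  have ef : e = cone_edge v f.
    apply/setP => x; apply/idP/idP => [xe|].
      have := es x xe; case: x xe => [a|[a w]] xe; rewrite !in_edge // inE.
      by case/andP => /eqP av _; rewrite inE -av xe eqxx.
    case: x => [a|[a w]]; rewrite in_edge; first by move/eqP ->.
    by case/andP => /= /eqP ->; rewrite inE.
  exists f => //; rewrite inE -eqSS -(card_cone_edge v) -ef ek prednK //.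
  by rewrite ltnW.
- by case=> f fE ->; constructor 1; apply/exists_inP; exists f.
- case=> v [f fE ->]; constructor 2; apply/existsP; exists v.
  by apply/exists_inP; exists f.
case=> v [f]; rewrite inE => /eqP fk ->; constructor 3; apply/existsP; exists v.
have k1 : 0 < k by apply: ltnW.
rewrite inl_cone_edge card_cone_edge fk prednK // !eqxx /=; apply/andP; split.
  by apply: setUS; apply: imsetS; apply/subsetP.
have [w wf] : exists w, w \in f.
  by apply/set0Pn; rewrite -card_gt0 fk -ltnS prednK.
by apply/existsP; exists w; rewrite in_edge eqxx.
Qed.

Lemma codeg_corona_ll a b :
  a != b -> codeg corona (inl a) (inl b) = codeg E0 a b.
Proof.
move=> neab; rewrite /codeg -(card_imset _ base_edge_inj).
apply: eq_card => e; rewrite inE; apply/andP/imsetP => [[]|[f]].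
  case/coronaP => [[f fE]|[v [f fE]]|[v [f fE]]] ->; rewrite !in_edge //.
    by move=> ab; exists f; rewrite // inE fE.
  by case/andP => /eqP av /eqP bv; rewrite av bv eqxx in neab.
rewrite inE => /andP[fE ab] ->; rewrite !in_edge; split=> //.
by apply/coronaP; constructor 1; exists f.
Qed.

Lemma codeg_corona_lr a u :
  codeg corona (inl a) (inr u) =
  (a == u.1) * codeg (ksets W k.-1) u.2 u.2.
Proof.
have [->|neau] := eqVneq; last first.
  apply: eq_card0 => e; rewrite inE; apply/negP => /andP[].
  case/coronaP => [[f fE]|[v [f fE]]|[v [f fE]]] ->;
    rewrite !in_edge ?andbF //.
  by case/and3P => /eqP av /eqP uv; rewrite av uv eqxx in neau.
rewrite mul1n /codeg -(card_imset _ (@cone_edge_inj u.1)).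
apply: eq_card => e; rewrite inE; apply/andP/imsetP => [[]|[f]].
  case/coronaP => [[f fE]|[v [f fE]]|[v [f fE]]] ->;
    rewrite !in_edge ?andbF //.
  by case/and3P => /eqP -> _ uf; exists f; rewrite // inE fE uf.
rewrite inE => /and3P[fE uf _] ->; rewrite !in_edge uf eqxx; split=> //.
by apply/coronaP; constructor 3; exists u.1, f.
Qed.

(** Copy edges and cone edges are told apart by the apex, so their counts add. The case [u = v] is
    included and gives the degree of a copy vertex. *)
Lemma codeg_corona_rr u v :
  codeg corona (inr u) (inr v) =
  (u.1 == v.1) * (codeg E u.2 v.2 + codeg (ksets W k.-1) u.2 v.2).
Proof.
have [uv|neuv] := eqVneq; last first.
  apply: eq_card0 => e; rewrite inE; apply/negP => /andP[].
  case/coronaP => [[f fE]|[x [f fE]]|[x [f fE]]] ->;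
    rewrite !in_edge ?andbF //; case/andP => /andP[/eqP ux _] /andP[/eqP vx _];
  by rewrite ux vx eqxx in neuv.
rewrite mul1n.
pose A := copy_edge u.1 @: [set f in E | (u.2 \in f) && (v.2 \in f)].
pose B := cone_edge u.1 @: [set f in ksets W k.-1 | (u.2 \in f) && (v.2 \in f)].
have <- : #|A| = codeg E u.2 v.2 by apply/card_imset/copy_edge_inj.
have <- : #|B| = codeg (ksets W k.-1) u.2 v.2 by apply/card_imset/cone_edge_inj.
have AB0 : A :&: B = set0.
  apply/setP => e; rewrite !inE; apply/negP => /andP[/imsetP[f _ ->]].
  by case/imsetP => g _ /setP/(_ (inl u.1)); rewrite !in_edge eqxx.
rewrite -cardsUI AB0 cards0 addn0.
apply: eq_card => e; rewrite in_set in_setU.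
apply/andP/orP => [[]|[]].
- case/coronaP => [[f fE]|[x [f fE]]|[x [f fE]]] ->;
    rewrite !in_edge ?andbF // -uv => /andP[/andP[/eqP <- uf] /andP[_ vf]].
    by left; apply/imsetP; exists f; rewrite // inE fE uf vf.
  by right; apply/imsetP; exists f; rewrite // inE fE uf vf.
- case/imsetP => f; rewrite inE => /and3P[fE uf vf] ->.
  rewrite !in_edge uf vf -uv eqxx; split=> //.
  by apply/coronaP; constructor 2; exists u.1, f.
case/imsetP => f; rewrite inE => /and3P[fE uf vf] ->.
rewrite !in_edge uf vf -uv eqxx; split=> //.
by apply/coronaP; constructor 3; exists u.1, f.
Qed.

(** Only the cones with apex [a] are counted; hyperedges of [E0] can only raise the degree. *)
Lemma codeg_corona_root a :
  'C(#|W|, k.-1) <= codeg corona (inl a) (inl a).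
Proof.
have <- : #|ksets W k.-1| = 'C(#|W|, k.-1) by apply: card_draws.
rewrite -(card_imset _ (@cone_edge_inj a)); apply: subset_leq_card.
apply/subsetP => _ /imsetP[f fk ->]; rewrite inE !in_edge eqxx !andbT.
by apply/coronaP; constructor 3; exists a, f.
Qed.

Lemma corona_not_regular r :
  0 < #|V| -> 0 < #|W| -> kr_regular k r E -> E != ksets W k ->
  ~ regular_hg corona.
Proof.
move=> /card_gt0P[v _] /card_gt0P[w _] E_reg neE [s s_reg].
have := codeg_corona_root v; rewrite -hdegE s_reg -(s_reg (inr (v, w))) hdegE.
rewrite codeg_corona_rr eqxx mul1n -hdegE (proj2 E_reg) /= codeg_ksets eqxx.
move: k_gt1 E_reg neE; case: k => [|[|j]] //= _ E_reg neE.
rewrite mul1n subSS subn0 subn1 leqNgt => /negP; apply.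
have W0 : 0 < #|W| by apply/card_gt0P; exists w.
(* Pascal's rule cancels the cone part of the copy degree and leaves the bound on [r] that expresses
   incompleteness. *)
rewrite -[#|W| in X in _ < X](prednK W0) binS ltn_add2r.
by rewrite (hdeg_lt_complete w E_reg).
Qed.

End CoronaCodegree.

(** * Characteristic polynomials of Seidel matrices *)

Section SeidelCharPoly.
Local Open Scope ring_scope.

(** Over the rationals, the determinant is [(- 2) ^+ m] times the characteristic polynomial of [A]
    at [- (X + a) / 2]. *)
Lemma cospectral_det_shift m n (A : 'M[int]_m) (B : 'M[int]_n) (a : {poly int}) :
  (size a <= 1)%N -> m = n -> char_poly A = char_poly B ->
  \det (('X + a)%:M + 2 *: map_mx polyC A) =
  \det (('X + a)%:M + 2 *: map_mx polyC B).
Proof.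
move=> /size1_polyC -> eqmn AB; move: (a`_0) => c {a}.
(* Composing with g turns X + c into - 2 X without dividing by 2. *)
pose g : {poly int} := (- 2)%:P * 'X + (- c)%:P.
have g1 : (1 < size g)%N by rewrite size_MXaddC polyC_eq0 /= size_polyC.
have detg p (M : 'M[int]_p) :
    \det (('X + c%:P)%:M + 2 *: map_mx polyC M) \Po g =
    (- 2) ^+ p * char_poly M.
  rewrite -(det_map_mx (comp_poly g)) -detZ; congr (\det _).
  apply/matrixP => i j; rewrite !mxE.
  have two : 2 \Po g = 2 :> {poly int} by rewrite -polyCMn comp_polyC.
  rewrite [LHS]comp_polyD comp_polyM two comp_polyC.
  rewrite mulrBr [- 2 * (_)%:P]mulNr opprK.
  congr (_ + _); case: (i == j); last by rewrite !mulr0n mulr0 comp_poly0.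
  rewrite !mulr1n comp_polyD comp_polyX comp_polyC /g [(- c)%:P]polyCN addrNK.
  by rewrite polyCN polyCMn.
(* Composition with the nonconstant [g] is injective, so equality may be tested after it. *)
apply/eqP; rewrite -subr_eq0 -(comp_poly_eq0 _ g1) rmorphB /= !detg.
by rewrite AB eqmn subrr.
Qed.

Lemma polyC_natz (n : nat) : (n%:Z)%:P = n%:R :> {poly int}.
Proof. by rewrite -natz rmorph_nat. Qed.

Definition adj_poly (W : finType) (E : {set {set W}}) (x y : W) : {poly int} :=
  if x == y then 0 else (codeg E x y)%:R.

Lemma char_poly_seidel (W : finType) (E : {set {set W}}) :
  char_poly (seidelmx E) =
  \det (fun_mx (fun x y => ('X + 1) *+ (x == y) - 1 + 2 * adj_poly E x y)).
Proof.
congr (\det _); apply/matrixP => i j.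
rewrite !mxE /adj_poly (inj_eq enum_val_inj).
case: eqVneq => _.
  by rewrite !mulr1n subrr mulr0 subr0; ring.
by rewrite !mulr0n !polyCB polyCM !polyC_natz -/(codeg E _ _); ring.
Qed.

Section CoronaSeidel.
Variables (V W : finType) (k r : nat).
Variables (E0 : {set {set V}}) (E : {set {set W}}).
Hypotheses (k_gt1 : (1 < k)%N) (E_reg : kr_regular k r E).

Definition cone_deg m := 'C(m - 1, k.-1 - 1).
Definition cone_codeg m := ((2 <= k.-1) * 'C(m - 2, k.-1 - 2))%N.

(** This is the matrix [K] of the overview. The base diagonal has [X] in place of [X + 1] because
    [corona_diag] already supplies 1. *)
Definition corona_rest m (s t : V + V) : {poly int} :=
  match s, t with
  | inl a, inl b => 'X *+ (a == b) - 1 + 2 * adj_poly E0 a b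
  | inr a, inr b => (2 * (cone_codeg m)%:R) *+ (a == b) - 1
  | inl a, inr b | inr a, inl b => (2 * (cone_deg m)%:R) *+ (a == b) - 1
  end.

(** [corona_rest] adds [2 * cone_codeg] to every entry of a copy block; the shift removes it from
    the diagonal, where adjacency is zero. *)
Definition copy_shift m : {poly int} := 1 - 2 * (cone_codeg m)%:R.

Lemma size_copy_shift m : (size (copy_shift m) <= 1)%N.
Proof. by rewrite /copy_shift -natrM -polyC_natz -polyCB size_polyC leq_b1. Qed.

Lemma copy_eigen_neq0 m j : 'X + copy_shift m + 2 * j%:R != 0.
Proof.
rewrite -addrA [_ + 2 * _]size1_polyC -?size_poly_eq0 ?size_XaddC //.
apply: leq_trans (size_polyD _ _) _; rewrite geq_max size_copy_shift.
by rewrite -natrM -polyC_natz size_polyC leq_b1.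
Qed.

(** On the right, [E] occurs only in the first determinant; the second sees it only through [r], [k]
    and [m]. *)
Lemma det_corona_seidel m :
  #|W| = m ->
  let lam := 'X + copy_shift m + 2 * (r * k.-1)%:R in
  char_poly (seidelmx (corona1 k E0 E)) * lam ^+ #|V| =
  \det (('X + copy_shift m)%:M + 2 *: map_mx polyC (adjmx E)) ^+ #|V| *
  \det (fun_mx (fun s t => (s == t)%:R * quot_diag lam s +
                           corona_rest m s t * quot_diag m%:R t)).
Proof.
move=> <- lam; rewrite char_poly_seidel.
pose N w w' := ('X + copy_shift #|W|) *+ (w == w') + 2 * adj_poly E w w'.
have N_lam w : \sum_w' N w w' = lam.
  rewrite (bigD1 w) //= {1}/N /adj_poly eqxx mulr1n mulr0 addr0; congr (_ + _).
  rewrite -(sum_codeg w E_reg) natr_sum mulr_sumr; apply: eq_bigr => w' neww'.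
  by rewrite /N /adj_poly eq_sym (negPf neww') mulr0n add0r.
have -> : ('X + copy_shift #|W|)%:M + 2 *: map_mx polyC (adjmx E) = fun_mx N.
  apply/matrixP => i j; rewrite !mxE /N /adj_poly (inj_eq enum_val_inj).
  by case: eqP => _; rewrite // polyC_natz.
rewrite -(det_corona (corona_rest #|W|) N_lam); congr (\det _ * _).
have k1 : (0 < k.-1)%N by rewrite -ltnS prednK // ltnW.
apply: eq_fun_mx => -[a|u] [b|v] /=; rewrite /adj_poly.
- rewrite (inj_eq inl_inj); case: eqVneq => [_|neab].
    by rewrite !mulr1n; ring.
  by rewrite codeg_corona_ll // !mulr0n; ring.
- rewrite -[inl _ == inr _]/false codeg_corona_lr // codeg_ksets eqxx k1.
  by case: eqP => _; rewrite /cone_deg !(mulr1n, mulr0n) ?mul1n; ring.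
- rewrite -[inr _ == inl _]/false codegC codeg_corona_lr // codeg_ksets eqxx k1.
  rewrite [b == _]eq_sym.
  by case: eqP => _; rewrite /cone_deg !(mulr1n, mulr0n) ?mul1n; ring.
case: u v => [a w] [b w'] /=.
rewrite codeg_corona_rr // codeg_ksets (inj_eq inr_inj) xpair_eqE /N /adj_poly.
rewrite /copy_shift /cone_codeg /=.
case: (a == b); last by rewrite !mulr0n; ring.
case: (w == w'); rewrite /= !(mulr1n, mulr0n) ?mul1n ?natrD; ring.
Qed.

End CoronaSeidel.
End SeidelCharPoly.

Theorem theorem6p2 (V0 W1 W2 : finType) (k r m : nat)
    (E0 : {set {set V0}}) (E1 : {set {set W1}}) (F1 : {set {set W2}}) :
  (1 <= #|V0|)%N ->
  is_hypergraph E0 -> uniform k E0 ->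
  #|W1| = m -> #|W2| = m -> (2 <= m)%N ->
  (2 <= k)%N -> (k <= m.+1)%N ->
  is_hypergraph E1 -> kr_regular k r E1 ->
  is_hypergraph F1 -> kr_regular k r F1 ->
  ~ hg_isomorphic E1 F1 ->
  cospectral (adjmx E1) (adjmx F1) ->
  ~ regular_hg (corona1 k E0 E1) /\ ~ regular_hg (corona1 k E0 F1) /\
  cospectral (seidelmx (corona1 k E0 E1)) (seidelmx (corona1 k E0 F1)).
Proof.
move=> V_gt0 E0_hg E0_unif cardW1 cardW2 m_gt1 k_gt1 k_le E1_hg E1_reg F1_hg
  F1_reg niso cosp.
have m_gt0 : 0 < m by apply: ltnW.
have neE1 : E1 != ksets W1 k /\ F1 != ksets W2 k.
  (* Completeness depends only on [r], [k] and [m], so one complete hypergraph would make both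
     complete, hence isomorphic. *)
  suff eqv : (E1 == ksets W1 k) = (F1 == ksets W2 k).
    rewrite eqv; suff neF : F1 != ksets W2 k by [].
    apply/negP => /[dup] FK; rewrite -eqv => /eqP E1K; apply: niso.
    by rewrite E1K (eqP FK); apply: ksets_isomorphic; rewrite cardW1 cardW2.
  have /card_gt0P[w1 _] : 0 < #|W1| by rewrite cardW1.
  have /card_gt0P[w2 _] : 0 < #|W2| by rewrite cardW2.
  rewrite -(prednK (ltnW k_gt1)) in E1_reg F1_reg *; apply: negb_inj.
  rewrite -(hdeg_lt_complete w1 E1_reg) -(hdeg_lt_complete w2 F1_reg).
  by rewrite cardW1 cardW2.
case: neE1 => neE1 neF1.
split; last split.
- by apply: corona_not_regular E1_reg neE1; rewrite ?cardW1.
- by apply: corona_not_regular F1_reg neF1; rewrite ?cardW2.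
have /= E1_det := det_corona_seidel E0 k_gt1 E1_reg cardW1.
have /= F1_det := det_corona_seidel E0 k_gt1 F1_reg cardW2.
have eqW : #|W1| = #|W2| by rewrite cardW1 cardW2.
move: E1_det; rewrite (cospectral_det_shift (size_copy_shift k m) eqW cosp) -F1_det.
(* The common factor is a power of a polynomial of degree 1, so it cancels in the integral
   domain. *)
apply: mulIf; by rewrite expf_neq0 // copy_eigen_neq0.
Qed.
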